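(* Consider the complete-graph planted matching model with parameters $(n,\mathcal{P},\mathcal{Q})$ described in the context, and suppose that \[ \sqrt{n}\;B(\mathcal{P},\mathcal{Q})\le 1+\epsilon \] for some $\epsilon\ge0$. Then there exists a universal constant $C>0$ such that for all sufficiently large $n$, \[ \mathbb{E}[\ell(M^*,\hat M_{\mathsf{ML}})]\le C\max\left\{\log(1+\epsilon),\sqrt{\frac{\log n}{n}}\right\}. \]
   Context: Complete-graph planted matching model with parameters $(n,\mathcal{P},\mathcal{Q})$, where $\mathcal{P},\mathcal{Q}$ are arbitrary probability distributions on a common space: $M^*$ is a uniformly random perfect matching of the complete bipartite graph $K_{n,n}$ (left vertices $[n]$, right vertices $[n]'$); every edge $e$ of $K_{n,n}$ receives an independent weight $W_e$ with distribution $\mathcal{P}$ if $e\in M^*$ and $\mathcal{Q}$ otherwise. $\hat M_{\mathsf{ML}}$ is any perfect matching maximizing the likelihood $\prod_{e\in M}f(W_e)\prod_{e\notin M}g(W_e)$ over perfect matchings $M$, where $f,g$ are densities of $\mathcal{P},\mathcal{Q}$ with respect to a common dominating measure $\mu$. $\ell(\hat M,M^* )=\frac1n|M^*\triangle\hat M|$, and $B(\mathcal{P},\mathcal{Q})=\int\sqrt{fg}\,d\mu$. *)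

(* Defs.v *)
From HB Require Import structures.
From mathcomp Require Import all_boot all_order all_algebra all_fingroup.
From mathcomp Require Import all_classical all_reals all_analysis.
Set Implicit Arguments. Unset Strict Implicit. Unset Printing Implicit Defensive.
Import Order.TTheory GRing.Theory Num.Theory.
Local Open Scope classical_set_scope.
Local Open Scope ring_scope.

(* A perfect matching of K_{n,n} (left [n], right [n]') is identified with a
   permutation s of 'I_n : its edge set is {(i, s i) | i}. *)
Definition edges (n : nat) (s : {perm 'I_n}) : {set 'I_n * 'I_n} :=
  [set (i, s i) | i : 'I_n].

Definition match_loss (R : realType) (n : nat) (s t : {perm 'I_n}) : R :=
  (#|(edges s :\: edges t) :|: (edges t :\: edges s)|%:R / n%:R).

Definition dlaw (d : measure_display) (T : measurableType d) (R : realType)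
  (mu : {measure set T -> \bar R}) (h : T -> R) (A : set T) : \bar R :=
  (\int[mu]_(x in A) (h x)%:E)%E.

Definition is_density (d : measure_display) (T : measurableType d) (R : realType)
  (mu : {measure set T -> \bar R}) (h : T -> R) : Prop :=
  (forall x, 0 <= h x) /\ measurable_fun setT h /\
  (\int[mu]_x (h x)%:E = 1)%E.

Definition bhatt (d : measure_display) (T : measurableType d) (R : realType)
  (mu : {measure set T -> \bar R}) (f g : T -> R) : \bar R :=
  (\int[mu]_x (Num.sqrt (f x * g x))%:E)%E.

Definition lik (T : Type) (R : realType) (n : nat) (f g : T -> R)
  (w : 'I_n -> 'I_n -> T) (s : {perm 'I_n}) : R :=
  \prod_(i < n) \prod_(j < n) (if s i == j then f (w i j) else g (w i j)).

Definition is_ML (T : Type) (R : realType) (n : nat) (f g : T -> R)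
  (w : 'I_n -> 'I_n -> T) (t : {perm 'I_n}) : Prop :=
  forall s : {perm 'I_n}, lik f g w s <= lik f g w t.

(* The joint law of (M*, W) on the probability space (Omega, Pr) is the planted
   matching model: M* uniform over the n! perfect matchings, and given M* = s the
   n^2 weights are independent, W_ij ~ P (density f) if s i = j, else ~ Q (density g).
   Stated through all finite-dimensional rectangles. *)
Definition planted_model (d : measure_display) (T : measurableType d)
  (dO : measure_display) (Omega : measurableType dO) (R : realType) (n : nat)
  (mu : {measure set T -> \bar R}) (f g : T -> R) (Pr : probability Omega R)
  (Mstar : Omega -> {perm 'I_n}) (W : 'I_n -> 'I_n -> Omega -> T) : Prop :=
  (forall s, measurable [set om | Mstar om = s]) /\
  (forall i j, measurable_fun setT (W i j)) /\
  (forall (s : {perm 'I_n}) (A : 'I_n -> 'I_n -> set T),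
     (forall i j, measurable (A i j)) ->
     Pr [set om | Mstar om = s /\ forall i j, A i j (W i j om)] =
     ((n`!%:R)^-1%:E *
       \prod_(i < n) \prod_(j < n)
          (if s i == j then dlaw mu f (A i j) else dlaw mu g (A i j)))%E).

(* Main.v *)
(* For permutations s, t disagreeing at k points, Markov's inequality applied to
   sqrt (lik t / lik s), whose mean factors over the edges, bounds the probability
   that M* = s and the ML estimator is t by B ^ (2k) / n!.  At most n ^_ k
   permutations disagree with s at exactly k points, and
     n ^_ k * B ^ (2k) <= exp (- k (k - 1) / (2n)) * (1 + eps) ^ (2k),
   which is at most n ^ -2 once k >= 8 n max (ln (1 + eps)) (sqrt (ln n / n)).
   Smaller k contribute at most 2k/n to the loss. *)
Require Import Defs.
From HB Require Import structures.
From mathcomp Require Import all_boot all_order all_algebra all_fingroup.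
From mathcomp Require Import all_classical all_reals all_analysis.
From mathcomp Require Import measurable_realfun ring lra.
Set Implicit Arguments. Unset Strict Implicit. Unset Printing Implicit Defensive.
Import Order.TTheory GRing.Theory Num.Theory.
Local Open Scope classical_set_scope.
Local Open Scope ring_scope.

(** * Transfer of integrals from indicators to nonnegative measurable functions *)

Section transfer.
Context d (X : measurableType d) (R : realType) (mu : {measure set X -> \bar R}).
Context dT (T : measurableType dT) (F : X -> R) (W : X -> T).
Hypotheses (F0 : forall x, 0 <= F x) (mF : measurable_fun setT F)
  (mW : measurable_fun setT W).

Import HBNNSimple.

(** Reduces a simple [g] to its level sets, so that only integrals of [F] against indicators in [W]
    remain. *)
Lemma integral_mul_nnsfun (g : {nnsfun T >-> R}) :
  (\int[mu]_x (F x * g (W x))%:E =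
   \sum_(r \in range g) (r%:E * \int[mu]_x (F x * \1_(g @^-1` [set r]) (W x))%:E))%E.
Proof.
have mI r : measurable_fun setT (fun x => F x * \1_(g @^-1` [set r]) (W x)).
  by apply: measurable_funM => //; exact: measurableT_comp.
have rge r : range g r -> 0 <= r by case=> x _ <-.
transitivity (\int[mu]_x
    (\sum_(r \in range g) (r * (F x * \1_(g @^-1` [set r]) (W x)))%:E)%E)%E.
  apply: eq_integral => x _; rewrite [g (W x)]fimfunE fsumEFin//; congr EFin.
  rewrite !fsbig_finite//= mulr_sumr; apply: eq_bigr => r _.
  by rewrite mulrCA.
(* Nonnegativity is needed for every real [r]: outside the range of [g], where [r] may be negative,
   the level set is empty and the term is 0. *)
have P r x : 0 <= r * (F x * \1_(g @^-1` [set r]) (W x)).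
  have [/rge r0|r0] := pselect (range g r).
    by rewrite !mulr_ge0// indicE.
  rewrite indicE memNset ?mulr0// => gr; apply: r0.
  by exists (W x).
rewrite ge0_integral_fsum//; last 2 first.
- by move=> r; apply/measurable_EFinP; apply: measurable_funM.
- by move=> r x _; rewrite lee_fin.
apply: eq_fsbigr => r /set_mem /rge r0.
under eq_integral do rewrite EFinM.
rewrite ge0_integralZl_EFin//.
- by move=> x _; rewrite lee_fin mulr_ge0// indicE.
- exact/measurable_EFinP.
Qed.

Lemma cvg_integral_mul_nnsfun_approx (phi : T -> R) (mphi : measurable_fun setT (EFin \o phi)) :
  (forall y, 0 <= phi y) ->
  (\int[mu]_x (F x * (nnsfun_approx measurableT mphi n) (W x))%:E @[n --> \oo]
   --> \int[mu]_x (F x * phi (W x))%:E)%E.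
Proof.
move=> phi0; pose g := nnsfun_approx measurableT mphi.
rewrite (_ : (\int[mu]_x (F x * phi (W x))%:E)%E =
  (\int[mu]_x limn (fun n => (F x * g n (W x))%:E))%E); last first.
  apply: eq_integral => x _; apply/esym/cvg_lim => //.
  rewrite EFinM; under eq_fun do rewrite EFinM.
  apply: cvgeZl => //.
  by apply: cvg_nnsfun_approx => // y _; rewrite /= lee_fin.
apply: cvg_monotone_convergence => //.
- by move=> n; apply/measurable_EFinP; apply: measurable_funM => //; exact: measurableT_comp.
- by move=> n x _; rewrite lee_fin mulr_ge0.
- move=> x _ a b ab; rewrite lee_fin ler_wpM2l//.
  by have /lefP := nd_nnsfun_approx measurableT mphi ab; apply.
Qed.
End transfer.

Section eq_transfer.
Import HBNNSimple.

(** The simple approximants of [phi] live on [T], hence serve both spaces at once. The two integrals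
    agree on them by linearity, and monotone convergence passes to the limit. *)
Lemma eq_integral_transfer {d d' dT} {X : measurableType d} {Y : measurableType d'}
  {T : measurableType dT} {R : realType} (mu : {measure set X -> \bar R})
  (nu : {measure set Y -> \bar R}) (F : X -> R) (G : Y -> R) (W : X -> T) (V : Y -> T)
  (phi : T -> R) :
  (forall x, 0 <= F x) -> measurable_fun setT F -> measurable_fun setT W ->
  (forall y, 0 <= G y) -> measurable_fun setT G -> measurable_fun setT V ->
  (forall A, measurable A -> (\int[mu]_x (F x * \1_A (W x))%:E =
     \int[nu]_y (G y * \1_A (V y))%:E)%E) ->
  (forall t, 0 <= phi t) -> measurable_fun setT phi ->
  (\int[mu]_x (F x * phi (W x))%:E = \int[nu]_y (G y * phi (V y))%:E)%E.
Proof.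
move=> F0 mF mW G0 mG mV FG phi0 /measurable_EFinP mphi.
have cF := cvg_integral_mul_nnsfun_approx (mu := mu) F0 mF mW mphi phi0.
have cG := cvg_integral_mul_nnsfun_approx (mu := nu) G0 mG mV mphi phi0.
apply: cvg_unique cF _ => //; apply: cvg_trans cG.
apply: near_eq_cvg; apply: nearW => n; rewrite !integral_mul_nnsfun//.
apply: eq_fsbigr => r _; rewrite FG//; exact: measurable_funPTI.
Qed.
End eq_transfer.

(** * Mean of a product of functions of independent weights *)

Section product.
Context {dO dT : measure_display} {Omega : measurableType dO} {T : measurableType dT}
  {R : realType} (P : {measure set Omega -> \bar R}) (mu : {measure set T -> \bar R})
  (I : finType) (D : set Omega) (W : I -> Omega -> T) (h : I -> T -> R) (k : R).
Hypotheses (mD : measurable D) (mW : forall i, measurable_fun setT (W i))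
  (h0 : forall i t, 0 <= h i t) (mh : forall i, measurable_fun setT (h i))
  (hfin : forall i, (\int[mu]_t (h i t)%:E < +oo)%E) (k0 : 0 <= k).
Hypothesis PW : forall A : I -> set T, (forall i, measurable (A i)) ->
  P (D `&` [set om | forall i, A i (W i om)]) =
  (k%:E * \prod_i \int[mu]_(t in A i) (h i t)%:E)%E.

Lemma integral_prod_indep (phi : I -> T -> R) (c : I -> R) :
  (forall i t, 0 <= phi i t) -> (forall i, measurable_fun setT (phi i)) ->
  (forall i, \int[mu]_t (h i t * phi i t)%:E = (c i)%:E)%E ->
  (\int[P]_om (\1_D om * \prod_i phi i (W i om))%:E = (k * \prod_i c i)%:E)%E.
Proof.
(* One by one, indicators are replaced with general functions: as a function of
   the set A, the integral with phi i = \1_A determines the one with any phi i. *)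
have : forall i, i \notin enum I -> exists2 A, measurable A & phi i = \1_A.
  by move=> i; rewrite mem_enum.
elim: (enum I) phi c => [|i r IHr] phi c indphi phi0 mphi cE.
  have /choice[A AP] : forall i, exists A, measurable A /\ phi i = \1_A.
    by move=> i; have [A] := indphi i isT; exists A.
  have mA i : measurable (A i) by have [] := AP i.
  have phiE i : phi i = \1_(A i) by have [] := AP i.
  have prodE om : \1_D om * \prod_i phi i (W i om) =
      \1_(D `&` [set om | forall i, A i (W i om)]) om :> R.
    rewrite indicI; congr (_ * _).
    have [h1|h1] := pselect (forall i, A i (W i om)).
      rewrite indicE mem_set// big1// => i _.
      by rewrite phiE indicE mem_set.
    rewrite indicE memNset//; move/existsNP: h1 => [i Ai].
    by rewrite (bigD1 i)//= phiE indicE memNset// mul0r.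
  under eq_integral do rewrite prodE.
  rewrite integral_indic//; last first.
    apply: measurableI => //.
    rewrite (_ : mkset _ = \bigcap_(i in [set: I]) (W i @^-1` A i)).
      apply: fin_bigcap_measurable => // i _.
      by rewrite -[_ @^-1` _]setTI; exact: mW.
    by apply/seteqP; split=> om /= H i; [move=> _; exact: H|exact: (H i Logic.I)].
  rewrite setIT PW// EFinM; congr (_ * _)%E.
  rewrite -prodEFin; apply: eq_bigr => i _.
  rewrite -cE phiE integral_mkcond; apply: eq_integral => t _.
  by rewrite patchE indicE; case: ifP => _; rewrite ?mulr1 ?mulr0.
(* All factors but the [i]-th are frozen: seen through [W i], the weight [F] on [Omega] must act as
   the density [K * h i] on [T]. *)
pose F om := \1_D om * \prod_(j | j != i) phi j (W j om).
pose K := k * \prod_(j | j != i) c j.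
have c0 j : 0 <= c j.
  by rewrite -lee_fin -cE integral_ge0// => t _; rewrite lee_fin mulr_ge0.
have K0 : 0 <= K by rewrite mulr_ge0// prodr_ge0.
have hindfin A : measurable A -> (\int[mu]_t (h i t * \1_A t)%:E \is a fin_num)%E.
  move=> mA; rewrite ge0_fin_numE; last first.
    by apply: integral_ge0 => t _; rewrite lee_fin mulr_ge0.
  apply: le_lt_trans (hfin i); apply: ge0_le_integral => //.
  - by move=> t _; rewrite lee_fin mulr_ge0.
  - by apply/measurable_EFinP; apply: measurable_funM.
  - exact/measurable_EFinP.
  - by move=> t _; rewrite lee_fin ler_piMr// indicE; case: (_ \in _).
transitivity (\int[P]_om (F om * phi i (W i om))%:E)%E.
  apply: eq_integral => om _; rewrite /F (bigD1 i)//=.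
  by rewrite (mulrC (phi i _)) mulrA.
have mF : measurable_fun setT F.
  apply: measurable_funM => //; under eq_fun do rewrite -big_filter.
  apply: measurable_prod => j _.
  exact: measurableT_comp.
transitivity (\int[mu]_t ((K * h i t) * phi i (idfun t))%:E)%E; last first.
  under eq_integral do rewrite -mulrA EFinM.
  rewrite ge0_integralZl_EFin//.
  - by rewrite cE -EFinM /K [in RHS](bigD1 i)//= (mulrC (c i)) mulrA.
  - by move=> t _; rewrite lee_fin mulr_ge0.
  - by apply/measurable_EFinP; apply: measurable_funM.
apply: eq_integral_transfer => //.
- by move=> om; rewrite mulr_ge0// prodr_ge0.
- by move=> t; rewrite mulr_ge0.
- exact: measurable_funM.
- exact: measurable_id.
move=> A mA.
(* With an indicator at [i], the induction hypothesis applies. The use of [fine] is harmless, since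
   [h i] has finite mass. *)
pose phi' j := if j == i then \1_A else phi j.
pose c' j := if j == i then fine (\int[mu]_t (h i t * \1_A t)%:E)%E else c j.
have := IHr phi' c'; rewrite [X in k * X](bigD1 i)//= /c' eqxx.
rewrite (eq_bigr c); last by move=> j /negbTE ->.
rewrite (mulrC (fine _)) mulrA EFinM fineK ?hindfin// => IH.
transitivity (\int[P]_om (\1_D om * \prod_j phi' j (W j om))%:E)%E.
  apply: eq_integral => om _; rewrite (bigD1 i)//= /phi' eqxx.
  rewrite [in RHS](eq_bigr (fun j => phi j (W j om))); last by move=> j /negbTE ->.
  by rewrite (mulrC (\1_A _)) mulrA.
rewrite IH.
- under [RHS]eq_integral do rewrite -mulrA EFinM.
  rewrite ge0_integralZl_EFin//.
  - by move=> t _; rewrite lee_fin mulr_ge0.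
  - by apply/measurable_EFinP; apply: measurable_funM.
- move=> j jr; rewrite /phi'; case: eqVneq => [_|ji]; first by exists A.
  by apply: indphi; rewrite inE negb_or ji.
- by move=> j t; rewrite /phi'; case: eqP.
- by move=> j; rewrite /phi'; case: eqP.
- move=> j; rewrite /phi'; case: eqP => // ->; by rewrite fineK// hindfin.
Qed.
End product.

(** * Square roots of density ratios, and disagreement sets *)

Lemma measurable_sqrt_div {d} {T : measurableType d} {R : realType} (u v : T -> R) :
  (forall x, 0 <= v x) -> measurable_fun setT u -> measurable_fun setT v ->
  measurable_fun setT (fun x => Num.sqrt (u x / v x)).
Proof.
move=> v0 mu mv; apply: (@measurableT_comp _ _ _ _ _ _ (@Num.sqrt R)).
  by apply: continuous_measurable_fun; exact: sqrt_continuous.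
apply: measurable_funM => //.
(* On nonnegative reals the inverse, with value 0 at 0, is the power -1, which is measurable. *)
under eq_fun do rewrite -powR_inv1//.
by apply: (measurableT_comp (measurable_powR _)).
Qed.

(** Turns the mean of the root of a density ratio into the integrand of [bhatt]. At [b = 0] both
    sides vanish. *)
Lemma mul_sqrt_div {R : realType} (a b : R) : 0 <= b ->
  b * Num.sqrt (a / b) = Num.sqrt (a * b).
Proof.
rewrite le_eqVlt => /predU1P[<-|b0]; first by rewrite mul0r mulr0 sqrtr0.
rewrite -[X in X * _](ger0_norm (ltW b0)) -sqrtr_sqr -sqrtrM ?sqr_ge0//.
by congr Num.sqrt; rewrite mulrC expr2 mulrA divfK ?gt_eqF.
Qed.

Definition disagree n (s t : {perm 'I_n}) : {set 'I_n} := [set i | s i != t i].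

(** A row where [s] and [t] differ has exactly two edges lying in just one of the matchings; any
    other row has none. *)
Lemma prod_disagree {R : realType} n (s t : {perm 'I_n}) (b : R) :
  \prod_(e : 'I_n * 'I_n) (if (s e.1 == e.2) == (t e.1 == e.2) then 1 else b) =
  b ^+ (2 * #|disagree s t|).
Proof.
rewrite -(pair_bigA _ (fun i j => if (s i == j) == (t i == j) then 1 else b))/=.
rewrite exprM -prodr_const [RHS]big_mkcond/=.
apply: eq_bigr => i _; rewrite inE; have [st|st]/= := eqVneq (s i) (t i).
  by rewrite st big1// => j _; rewrite eqxx.
rewrite (bigD1 (s i))//= eqxx (eq_sym (t i)) (negbTE st)/=.
rewrite (bigD1 (t i)) 1?eq_sym//= eqxx (negbTE st)/=.
rewrite big1 ?mulr1 ?expr2// => j /andP[js jt].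
by rewrite !(eq_sym _ j) (negbTE js) (negbTE jt).
Qed.

(** * Probability of mistaking one matching for another *)

Section pairwise_error.
Context {dO dT : measure_display} {Omega : measurableType dO} {T : measurableType dT}
  {R : realType} (n : nat) (Pr : probability Omega R) (mu : {measure set T -> \bar R})
  (f g : T -> R) (Mstar : Omega -> {perm 'I_n}) (W : 'I_n -> 'I_n -> Omega -> T)
  (Mhat : Omega -> {perm 'I_n}) (b : R).
Hypotheses (df : is_density mu f) (dg : is_density mu g)
  (bE : bhatt mu f g = b%:E) (model : planted_model mu f g Pr Mstar W)
  (mMhat : forall s, measurable [set om | Mhat om = s])
  (ML : forall om, is_ML f g (fun i j => W i j om) (Mhat om)).

Lemma pairwise_error (s t : {perm 'I_n}) :
  (Pr ([set om | Mstar om = s] `&` [set om | Mhat om = t]) <=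
   ((n`!%:R)^-1 * b ^+ (2 * #|disagree s t|))%:E)%E.
Proof.
have [mM [mW PrW]] := model.
have [f0 [mf f1]] := df; have [g0 [mg g1]] := dg.
pose h (u : {perm 'I_n}) (e : 'I_n * 'I_n) := if u e.1 == e.2 then f else g.
have h0 u e x : 0 <= h u e x by rewrite /h; case: ifP.
have mh u e : measurable_fun setT (h u e) by rewrite /h; case: ifP.
have h1 u e : (\int[mu]_x (h u e x)%:E = 1)%E by rewrite /h; case: ifP.
pose V (e : 'I_n * 'I_n) := W e.1 e.2.
have mV e : measurable_fun setT (V e) by exact: mW.
have likE u om : lik f g (fun i j => W i j om) u = \prod_e h u e (V e om).
  rewrite /lik pair_bigA/=; apply: eq_bigr => e _; rewrite /h /V.
  by case: ifP.
have PV (A : 'I_n * 'I_n -> set T) : (forall e, measurable (A e)) ->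
    Pr ([set om | Mstar om = s] `&` [set om | forall e, A e (V e om)]) =
    ((n`!%:R^-1)%:E * \prod_e \int[mu]_(x in A e) (h s e x)%:E)%E.
  move=> mA; rewrite (_ : _ `&` _ = [set om | Mstar om = s /\
      forall i j, (fun i j => A (i, j)) i j (W i j om)]); last first.
    apply/seteqP; split=> om /= [-> H]; split=> //.
    by move=> [i j]; exact: H.
  rewrite (PrW s (fun i j => A (i, j)))// pair_bigA/=.
  congr (_ * _)%E; apply: eq_bigr => -[i j] _.
  by rewrite /h /dlaw/=; case: ifP.
pose Ms := [set om | Mstar om = s].
pose Mt := [set om | Mhat om = t].
pose A e := [set x | 0 < h s e x].
have mA e : measurable (A e).
  rewrite (_ : A e = h s e @^-1` `]0, +oo[%classic).
    by rewrite -[_ @^-1` _]setTI; exact: mh.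
  by apply/seteqP; split=> x /=; rewrite in_itv/= andbT.
(* On [G] no ratio [h t e / h s e] has a zero denominator. *)
pose G := [set om | forall e, A e (V e om)].
have mG : measurable G.
  rewrite (_ : G = \bigcap_(e in [set: 'I_n * 'I_n]) (V e @^-1` A e)).
    apply: fin_bigcap_measurable => // e _.
    by rewrite -[_ @^-1` _]setTI; exact: mV.
  by apply/seteqP; split=> om /= H e; [move=> _; exact: H|exact: (H e Logic.I)].
have mMs : measurable Ms by exact: mM.
have mMt : measurable Mt by exact: mMhat.
have PMs : Pr Ms = (n`!%:R^-1)%:E.
  have := PV (fun=> setT) (fun=> measurableT).
  rewrite big1 ?mule1; last by move=> e _; exact: h1.
  by move=> <-; congr (Pr _); apply/seteqP; split=> om //= [].
(* Restricting each weight to where its own density is positive loses no mass. *)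
have PMsG : Pr (Ms `&` G) = (n`!%:R^-1)%:E.
  rewrite PV// big1 ?mule1// => e _.
  rewrite -(h1 s e) [LHS]integral_mkcond; apply: eq_integral => x _.
  rewrite patchE; case: ifPn => //; rewrite notin_setE /A/= => /negP.
  by rewrite -leNgt => hx; congr EFin; apply/eqP; rewrite eq_le h0 hx.
(* lik s > 0 almost surely on M* = s; elsewhere the ratio is the junk value 0. *)
have null : Pr (Ms `\` G) = 0%E.
  have lty : (Pr Ms < +oo)%E by rewrite PMs ltry.
  have -> : (Pr (Ms `\` G) = Pr Ms - Pr (Ms `&` G))%E by exact: measureD.
  by rewrite PMs PMsG subee.
(* Edges in both matchings or in neither have the same density under [s] and [t]; the factor 1 given
   to them avoids 0/0. *)
pose same e := (s e.1 == e.2) == (t e.1 == e.2) :> bool.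
pose phi e x := if same e then 1 else Num.sqrt (h t e x / h s e x).
have phi0 e x : 0 <= phi e x by rewrite /phi; case: ifP => //; rewrite sqrtr_ge0.
have mphi e : measurable_fun setT (phi e).
  by rewrite /phi; case: (same e); [exact: measurable_cst|exact: measurable_sqrt_div].
have phiV e x : 0 < h s e x -> phi e x ^+ 2 * h s e x = h t e x.
  move=> hx; rewrite /phi; case: ifPn => [/eqP E|_].
    by rewrite expr1n mul1r /h E.
  by rewrite sqr_sqrtr ?divr_ge0// divfK// gt_eqF.
have int_phi : (\int[Pr]_om (\1_Ms om * \prod_e phi e (V e om))%:E =
    ((n`!%:R)^-1 * \prod_e (if same e then 1 else b))%:E)%E.
  apply: (@integral_prod_indep _ _ _ _ _ _ mu _ _ _ (h s)) => //.
  - by move=> e; rewrite h1 ltry.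
  (* On the remaining edges one of [h s e], [h t e] is [f] and the other [g], so the mean is [b] in
     either order. *)
  - by move=> e; rewrite /phi; case: ifPn => [_|ne];
      [under eq_integral do rewrite mulr1; exact: h1|];
      under eq_integral do rewrite mul_sqrt_div//;
      rewrite -bE; apply: eq_integral => x _; move: ne; rewrite /same /h;
      do 2 case: ifP => //; rewrite mulrC.
rewrite -prod_disagree -int_phi.
apply: (@le_trans _ _ (Pr (Ms `&` Mt `&` G) + Pr (Ms `\` G))%E).
  apply: le_trans (measureU2 _ _ _) => //; last first.
  - exact: measurableD.
  - by apply: measurableI => //; exact: measurableI.
  apply: le_measure; rewrite ?inE//; first exact: measurableI.
    by apply: measurableU; [do 2 apply: measurableI => //|exact: measurableD].
  by move=> om [Msom Mtom]; have [Gom|Gom] := pselect (G om); [left|right].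
rewrite null adde0 -[Ms `&` _ `&` _]setIT -integral_indic//; last first.
  by do 2 apply: measurableI => //.
apply: ge0_le_integral => //.
- by apply/measurable_EFinP; apply: measurable_indic; do 2 apply: measurableI => //.
- apply/measurable_EFinP/measurable_funM => //.
  by apply: measurable_prod => e _; exact: measurableT_comp.
move=> om _; rewrite lee_fin indicE.
have [|] := boolP (om \in _); last by rewrite mulr_ge0// prodr_ge0.
rewrite inE => -[[Msom Mtom] Gom].
(* Squaring the product of the [phi e] gives the ratio of [lik] at [t] to [lik] at [s], at least 1
   because [t] is the maximizer. *)
rewrite indicE mem_set// mul1r -(@expr_ge1 _ 2)// ?prodr_ge0//.
have likpos : 0 < lik f g (fun i j => W i j om) s.
  by rewrite likE prodr_gt0// => e _; exact: Gom.
rewrite -(ler_pM2r likpos) mul1r [leRHS](_ : _ = lik f g (fun i j => W i j om) t).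
  by rewrite -Mtom; exact: ML.
rewrite !likE -prodrXl -big_split/=; apply: eq_bigr => e _.
exact/phiV/Gom.
Qed.
End pairwise_error.

(** * Loss and counting in terms of disagreements *)

(** Each half of the symmetric difference is covered by one edge per disagreeing row, whence the
    factor 2. *)
Lemma match_loss_le (R : realType) n (s t : {perm 'I_n}) :
  match_loss R s t <= 2 * #|disagree s t|%:R / n%:R.
Proof.
have D (u v : {perm 'I_n}) : (#|edges u :\: edges v| <= #|disagree u v|)%N.
  apply: leq_trans (leq_imset_card (fun i => (i, u i)) (mem (disagree u v))).
  apply: subset_leq_card; apply/fintype.subsetP => e /setDP[/imsetP[i _ ->] ev].
  apply: imset_f; rewrite inE; apply: contra ev => /eqP ->.
  exact: imset_f.
rewrite /match_loss ler_wpM2r ?invr_ge0// -natrM ler_nat.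
apply: leq_trans (leq_card_setU _ _) _; rewrite mul2n -addnn leq_add//.
apply: leq_trans (D _ _) _; apply: subset_leq_card; apply/fintype.subsetP => i.
by rewrite !inE eq_sym.
Qed.

(** Translation by [s] reduces to disagreement with the identity. Permutations are then grouped by
    support: there are ['C(n, k)] supports of size [k], each shared by at most [k!] permutations. *)
Lemma sum_disagree_le (R : numDomainType) n (s : {perm 'I_n}) (F : nat -> R) :
  (forall k, 0 <= F k) ->
  \sum_t F #|disagree s t| <= \sum_(k < n.+1) (n ^_ k)%:R * F k.
Proof.
move=> F0; pose supp (u : {perm 'I_n}) := disagree 1%g u.
rewrite (reindex_inj (mulIg s))/=.
rewrite (eq_bigr (fun u => F #|supp u|)); last first.
  move=> u _; congr (F _); apply: eq_card => i.
  by rewrite !inE perm1 permM (inj_eq perm_inj).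
rewrite (partition_big supp predT)//=.
rewrite (partition_big (fun A : {set 'I_n} => inord #|A| : 'I_n.+1) predT)//=.
apply: ler_sum => k _.
have cardA (A : {set 'I_n}) : (inord #|A| == k) = (#|A| == k).
  by rewrite -val_eqE/= inordK// ltnS -[leqRHS]card_ord max_card.
under eq_bigl do rewrite cardA.
have -> : (n ^_ k = #|[set A : {set 'I_n} | #|A| == k]%SET| * k`!)%N.
  by rewrite card_draws card_ord bin_ffact.
rewrite natrM -mulrA mulr_natl -sumr_const big_set/=; apply: ler_sum => A /eqP <-.
rewrite (eq_bigr (fun=> F #|A|)); last by move=> u /eqP ->.
rewrite sumr_const -[leLHS]mulr_natl ler_wpM2r// ler_nat.
rewrite -(card_perm A); apply: subset_leq_card; apply/fintype.subsetP => u uA.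
have /eqP <- : supp u == A := uA.
by apply/fintype.subsetP => i; rewrite !inE perm1 eq_sym.
Qed.

(** * Numerical estimates *)

(** The factors are [n - j <= n * expR (- j / n)] for [j < k], and these [j] sum to
    [k (k - 1) / 2]. *)
Lemma ffact_le_expR (R : realType) n k : (0 < n)%N ->
  (n ^_ k)%:R <= n%:R ^+ k * expR (- (k%:R * (k%:R - 1) / (2 * n%:R))) :> R.
Proof.
move=> n0; have n0R : 0 < n%:R :> R by rewrite ltr0n.
elim: k => [|k IHk]; first by rewrite mul0r mul0r oppr0 expR0 mulr1.
have step : (n - k)%:R <= n%:R * expR (- (k%:R / n%:R)) :> R.
  (* The maximum with 0 accounts for the truncated subtraction when [k > n]. *)
  apply: (@le_trans _ _ (n%:R * Num.max 0 (1 - k%:R / n%:R))).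
    have [kn|nk] := leqP k n; last by rewrite (eqP (ltnW nk)) mulr_ge0// le_max lexx.
    rewrite natrB// (_ : _ - _ = n%:R * (1 - k%:R / n%:R)); last first.
      by field; rewrite gt_eqF.
    by rewrite ler_wpM2l// le_max lexx orbT.
  by rewrite ler_wpM2l// ge_max expR_ge0 expR_ge1Dx.
rewrite ffactnSr natrM exprSr.
apply: le_trans (ler_pM _ _ IHk step) _ => //.
rewrite mulrACA -expRD ler_wpM2l ?mulr_ge0 ?exprn_ge0// ler_expR.
by rewrite -natr1 le_eqVlt; apply/orP; left; apply/eqP; field; rewrite gt_eqF.
Qed.

Lemma ffact_bhatt_le (R : realType) n k (b eps : R) :
  1 <= ln (n%:R : R) -> (0 < n)%N -> (k <= n)%N -> 0 <= b -> 0 <= eps ->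
  Num.sqrt n%:R * b <= 1 + eps ->
  8 * n%:R * Num.max (ln (1 + eps)) (Num.sqrt (ln (n%:R) / n%:R)) <= k%:R ->
  (n ^_ k)%:R * b ^+ (2 * k) <= (n%:R ^+ 2)^-1.
Proof.
move=> ln1 n0 kn b0 eps0 nb; set L := ln (1 + eps); set S := Num.sqrt _ => mk.
have n0R : 0 < n%:R :> R by rewrite ltr0n.
have eps1 : 0 < 1 + eps by lra.
have Lk : 8 * n%:R * L <= k%:R.
  by apply: le_trans mk; rewrite ler_wpM2l ?mulr_ge0// le_max lexx.
have Sk : 8 * n%:R * S <= k%:R.
  by apply: le_trans mk; rewrite ler_wpM2l ?mulr_ge0// le_max lexx orbT.
have S2 : n%:R * S ^+ 2 = ln (n%:R : R).
  rewrite sqr_sqrtr; last by rewrite divr_ge0// (le_trans ler01).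
  by rewrite mulrC divfK// gt_eqF.
have S0 : 0 <= S by exact: sqrtr_ge0.
have kn2 : k%:R <= n%:R :> R by rewrite ler_nat.
(* The left side is [(Num.sqrt n * b) ^+ (2 * k)]. *)
have nbk : n%:R ^+ k * b ^+ (2 * k) <= expR (2 * k%:R * L).
  rewrite exprM -exprMn -[n%:R in leLHS](@sqr_sqrtr R)// -exprMn -exprM.
  rewrite -natrM expRM_natl lnK ?posrE//.
  by apply: lerXn2r => //; rewrite nnegrE ?mulr_ge0// ltW.
apply: (@le_trans _ _ (expR (2 * k%:R * L - k%:R * (k%:R - 1) / (2 * n%:R)))).
  rewrite expRD; apply: le_trans (ler_wpM2r (expR_ge0 _) nbk).
  rewrite mulrAC ler_wpM2r ?exprn_ge0//; exact: ffact_le_expR.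
rewrite -[X in (X ^+ 2)^-1]lnK ?posrE// -expRM_natl -expRN ler_expR -S2.
rewrite -S2 in ln1.
have -> : k%:R * (k%:R - 1) / (2 * n%:R) = (k%:R ^+ 2 - k%:R) / 2 / n%:R :> R.
  by field; rewrite gt_eqF.
rewrite lerBlDr -lerBlDl ler_pdivlMr//.
(* After multiplication by [n], the gain is [(k^2 - k) / 2]. Half of [k^2 / 2] pays for [L]; the
   other half, at least [16 n^2 S^2], pays for [2 n^2 S^2] and for [k / 2], as
   [k <= n <= n^2 S^2]. *)
have h1 : 2 * k%:R * L * n%:R <= k%:R ^+ 2 / 4.
  have := ler_wpM2l (ler0n R k) Lk; lra.
have h2 : 64 * n%:R ^+ 2 * S ^+ 2 <= k%:R ^+ 2 :> R.
  rewrite (_ : 64 = 8 ^+ 2); last by ring.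
  by rewrite -!exprMn lerXn2r// nnegrE ?mulr_ge0.
have h3 : n%:R <= n%:R ^+ 2 * S ^+ 2.
  by have := ler_wpM2l (ltW n0R) ln1; rewrite mulr1 mulrA -expr2.
lra.
Qed.

(** * Reduction to finite sums and conclusion *)

Lemma integral_fin_valued {d} {Omega : measurableType d} {R : realType} {I : finType}
  (P : {measure set Omega -> \bar R}) (X : Omega -> I) (u : I -> R) :
  (forall i, measurable [set om | X om = i]) -> (forall i, 0 <= u i) ->
  (\int[P]_om (u (X om))%:E = \sum_i (u i)%:E * P [set om | X om = i])%E.
Proof.
move=> mX u0.
transitivity (\int[P]_om \sum_i ((u i)%:E * (\1_[set om | X om = i] om)%:E))%E.
  apply: eq_integral => om _; rewrite (bigD1 (X om))//= indicE mem_set// mule1.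
  rewrite big1 ?adde0// => i iX; rewrite indicE memNset ?mule0//=.
  by move=> /esym/eqP; rewrite (negbTE iX).
rewrite ge0_integral_sum//; last 2 first.
- by move=> i; apply/measurable_EFinP/measurable_funM.
- by move=> i om _; rewrite mule_ge0// lee_fin.
apply: eq_bigr => i _; rewrite ge0_integralZl_EFin//.
  by rewrite integral_indic// setIT.
exact/measurable_EFinP.
Qed.

Theorem theorem4 (R : realType) :
  exists C : R, 0 < C /\
  exists N : nat, forall n : nat, (N <= n)%N ->
  forall (d : measure_display) (T : measurableType d)
         (mu : {measure set T -> \bar R}) (f g : T -> R),
  is_density mu f -> is_density mu g ->
  forall eps : R, 0 <= eps ->
  ((Num.sqrt (n%:R))%:E * bhatt mu f g <= (1 + eps)%:E)%E ->
  forall (dO : measure_display) (Omega : measurableType dO)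
         (Pr : probability Omega R)
         (Mstar : Omega -> {perm 'I_n}) (W : 'I_n -> 'I_n -> Omega -> T)
         (Mhat : Omega -> {perm 'I_n}),
  planted_model mu f g Pr Mstar W ->
  (forall s, measurable [set om | Mhat om = s]) ->
  (forall om, is_ML f g (fun i j => W i j om) (Mhat om)) ->
  (\int[Pr]_om (match_loss R (Mstar om) (Mhat om))%:E
     <= (C * Num.max (ln (1 + eps)) (Num.sqrt (ln (n%:R) / n%:R)))%:E)%E.
Proof.
(* The constant is 16 for the pairs with few disagreements plus 4 for the others; the threshold
   beyond [expR 1] ensures [1 <= ln n]. *)
exists 20; split=> //; exists (Num.truncn (expR 1 : R)).+1 => n Nn.
move=> d T mu f g df dg eps eps0 nB dO Omega Pr Mstar W Mhat model mMhat ML.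
have en : expR 1 <= n%:R :> R.
  by apply: le_trans (ltW (truncnS_gt _)) _; rewrite ler_nat.
have n0R : 0 < n%:R :> R by apply: lt_le_trans en; exact: expR_gt0.
have n0 : (0 < n)%N by rewrite -(ltr0n R).
have ln1 : 1 <= ln (n%:R : R) by rewrite -[leLHS]expRK ler_ln ?posrE ?expR_gt0.
have B0 : (0 <= bhatt mu f g)%E.
  by apply: integral_ge0 => x _; rewrite lee_fin sqrtr_ge0.
have sn0 : 0 < Num.sqrt n%:R :> R by rewrite sqrtr_gt0.
(* An infinite value would contradict [nB], because [Num.sqrt n] is positive. *)
have [b bE] : exists b, bhatt mu f g = b%:E.
  case: (bhatt mu f g) B0 nB => [b _ _|_|//]; first by exists b.
  by rewrite gt0_muley ?lte_fin.
have b0 : 0 <= b by rewrite -lee_fin -bE.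
have nb : Num.sqrt n%:R * b <= 1 + eps by rewrite -lee_fin EFinM -bE.
set m := Num.max _ _.
have mn : n%:R^-1 <= m.
  rewrite le_max; apply/orP; right.
  rewrite -[leLHS]ger0_norm ?invr_ge0// -sqrtr_sqr ler_sqrt ?divr_ge0//; last first.
    exact: le_trans ln1.
  rewrite expr2 ler_wpM2r ?invr_ge0// (le_trans _ ln1)// invf_le1// ler1n//.
pose X om := (Mstar om, Mhat om).
have mM s : measurable [set om | Mstar om = s] by case: model.
have XE p : [set om | X om = p] = [set om | Mstar om = p.1] `&` [set om | Mhat om = p.2].
  by case: p => s t; apply/seteqP; split=> om /=; rewrite /X; [case|case=> -> ->].
have mX p : measurable [set om | X om = p] by rewrite XE; exact: measurableI.
pose q p := fine (Pr [set om | X om = p]).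
have qE p : Pr [set om | X om = p] = (q p)%:E by rewrite fineK ?fin_num_measure.
have q0 p : 0 <= q p by rewrite fine_ge0.
have intE (u : {perm 'I_n} * {perm 'I_n} -> R) : (forall p, 0 <= u p) ->
    (\int[Pr]_om (u (X om))%:E = (\sum_p u p * q p)%:E)%E.
  move=> u0; rewrite integral_fin_valued// -sumEFin.
  by apply: eq_bigr => p _; rewrite [RHS]EFinM -qE.
have q1 : \sum_p q p = 1.
  have P1 : (\int[Pr]_om (1 : R)%:E = 1)%E.
    by rewrite integral_cst// mul1e; exact: probability_setT.
  have := intE (fun=> 1) (fun=> ler01); rewrite P1 => -[->].
  by under eq_bigr do rewrite mul1r.
have loss0 s t : 0 <= match_loss R s t :> R by rewrite divr_ge0.
rewrite (intE (fun p => match_loss R p.1 p.2))// lee_fin.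
pose far k := 8 * n%:R * m <= k%:R.
pose dis (p : {perm 'I_n} * {perm 'I_n}) := #|disagree p.1 p.2|.
have m0 : 0 <= m by apply: le_trans mn; rewrite invr_ge0.
(* Below the threshold [8 n m] the loss is at most [16 m]; beyond it the trivial bound 2 is used. *)
have lossle p : match_loss R p.1 p.2 <= 16 * m + 2 * (far (dis p))%:R.
  apply: le_trans (match_loss_le _ _ _) _; rewrite -/(dis p).
  rewrite ler_pdivrMr//; have [fp|] := boolP (far _).
    have : (dis p)%:R <= n%:R :> R by rewrite ler_nat -[leqRHS]card_ord max_card.
    have := mulr_ge0 (ltW n0R) m0; rewrite /=; lra.
  by rewrite -ltNge /=; lra.
(* For each of the [n!] choices of [s], weighted by [1 / n!], the [n + 1] values of [k] contribute
   at most [1 / n^2] each, and [n + 1 <= 2 n]. *)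
have farle : \sum_p (far (dis p))%:R * q p <= 2 / n%:R.
  pose F k := (far k)%:R * b ^+ (2 * k).
  have F0 k : 0 <= F k by rewrite mulr_ge0// exprn_ge0.
  apply: (@le_trans _ _ (\sum_p n`!%:R^-1 * F (dis p))).
    apply: ler_sum => p _; rewrite mulrCA ler_wpM2l// -lee_fin -qE XE.
    exact: (pairwise_error df dg bE model).
  rewrite -(pair_bigA _ (fun s t => n`!%:R^-1 * F (dis (s, t))))/=.
  apply: (@le_trans _ _ (\sum_(s : {perm 'I_n}) n`!%:R^-1 * (2 / n%:R))).
    apply: ler_sum => s _; rewrite -mulr_sumr ler_wpM2l ?invr_ge0//.
    apply: le_trans (sum_disagree_le s F0) _.
    apply: (@le_trans _ _ (\sum_(k < n.+1) (n%:R ^+ 2)^-1)).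
      apply: ler_sum => k _; rewrite /F; have [fk|_] := boolP (far k).
        by rewrite mul1r; apply: (ffact_bhatt_le (eps := eps)); rewrite // -ltnS.
      by rewrite mul0r mulr0 invr_ge0 exprn_ge0.
    rewrite sumr_const card_ord -[leLHS]mulr_natl ler_pdivrMr ?exprn_gt0//.
    by rewrite expr2 mulrA divfK ?gt_eqF// -natr1 mulr_natl mulr2n lerD2l ler1n.
  rewrite sumr_const -[leLHS]mulr_natl mulrA -[leRHS]mul1r ler_wpM2r ?divr_ge0//.
  rewrite (_ : #|_| = n`!) ?divff// ?pnatr_eq0 -?lt0n ?fact_gt0//.
  by rewrite -[RHS]card_Sn; apply: eq_card.
apply: (@le_trans _ _ (\sum_p (16 * m + 2 * (far (dis p))%:R) * q p)).
  by apply: ler_sum => p _; rewrite ler_wpM2r.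
under eq_bigr do rewrite mulrDl -(mulrA 2).
rewrite big_split/= -!mulr_sumr q1 mulr1.
(* The far part [2 * (2 / n)] is at most [4 m] by [mn]. *)
lra.
Qed.
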